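(* Let $U\subseteq\mathbb H$ be an axially symmetric open set, let $f$ be a left slice hyperholomorphic function on $U$, and let $p\in U$. Assume that $f$ admits the $*$-Taylor expansion $$f(q)=\sum_{n=0}^\infty(q-p)^{*n}a_n,\qquad \{a_n\}_{n\in\mathbb N_0}\subset\mathbb H,$$ convergent absolutely and uniformly on the compact subsets of $\Omega(p,R)\subset U$, assumed nonempty, where $\frac1R=\limsup_{n\to\infty}|a_n|^{1/n}$, $R>0$. Then $$Df(q)=\sum_{n=0}^\infty\widetilde H_n(q,p)\,b_n,\qquad q\in\Omega(p,R),\qquad b_n:=-2(n+1)a_{n+1}.$$
   Context: $\mathbb H$ denotes the quaternions $q=q_0+q_1e_1+q_2e_2+q_3e_3$ with the usual relations ($e_i^2=-1$, $e_1e_2=-e_2e_1=e_3$, $e_2e_3=-e_3e_2=e_1$, $e_3e_1=-e_1e_3=e_2$), $\underline q=q_1e_1+q_2e_2+q_3e_3$, $\bar q=q_0-\underline q$, $\mathbb S=\{\underline q:|\underline q|=1\}$, $\mathbb C_I=\mathbb R+I\mathbb R$ for $I\in\mathbb S$, $[q]=\{q_0+I|\underline q|:I\in\mathbb S\}$. A set $U$ is axially symmetric if $[q]\subset U$ for all $q\in U$. Slice hyperholomorphic: for $U$ axially symmetric open and $\mathcal U=\{(u,v)\in\mathbb R^2:u+\mathbb Sv\subset U\}$, $f:U\to\mathbb H$ is left slice hyperholomorphic if $f(u+Iv)=\alpha(u,v)+I\beta(u,v)$ for all $(u,v)\in\mathcal U$, $I\in\mathbb S$, with $C^1$ functions $\alpha,\beta:\mathcal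 U\to\mathbb H$, $\alpha$ even and $\beta$ odd in $v$, satisfying $\partial_u\alpha=\partial_v\beta$, $\partial_v\alpha=-\partial_u\beta$. $D=\partial_{q_0}+e_1\partial_{q_1}+e_2\partial_{q_2}+e_3\partial_{q_3}$ acting from the left, in the variable $q$. $\Omega(p,R)$: choose $I\in\mathbb S$ with $p\in\mathbb C_I$ and let $D_I(p,R)=\{z\in\mathbb C_I:|z-p|<R\}$; then $\Omega(p,R)=\{x+Jy: J\in\mathbb S,\ x,y\in\mathbb R,\ x+yI\in D_I(p,R)\text{ and }x-yI\in D_I(p,R)\}$. $*$-powers and products (left $*$-product in $q$): $(q-p)^{*m}=\sum_{i=0}^m\binom mi q^i(-p)^{m-i}$, $(\bar q-p)^{*k}=\sum_{j=0}^k\binom kj\bar q^j(-p)^{k-j}$, and $(q-p)^{*m}*(\bar q-p)^{*k}=\sum_{i=0}^m\sum_{j=0}^k\binom mi\binom kj q^i\bar q^j(-p)^{m-i+k-j}$. $$\widetilde H_n(q,p)=\frac1{n+1}\sum_{k=1}^{n+1}(q-p)^{*(n+1-k)}*(\bar q-p)^{*(k-1)},\quad n\ge0.$$ *)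

(* Defs.v *)
From HB Require Import structures.
From mathcomp Require Import all_boot all_order all_algebra.
From mathcomp Require Import ring lra.
From mathcomp Require Import all_classical all_reals all_analysis.

Set Implicit Arguments.
Unset Strict Implicit.
Unset Printing Implicit Defensive.

Import Order.TTheory GRing.Theory Num.Theory.
Import numFieldNormedType.Exports.

Local Open Scope classical_set_scope.
Local Open Scope ring_scope.

Record quaternion (R : Type) :=
  Quaternion { q0 : R; q1 : R; q2 : R; q3 : R }.

Section QuaternionStructures.
Variable R : realType.
Local Notation H := (quaternion R).
Implicit Types x y z : H.

Definition quat_to_prod x : R * R * R * R := (q0 x, q1 x, q2 x, q3 x).
Definition quat_of_prod (t : R * R * R * R) : H :=
  Quaternion t.1.1.1 t.1.1.2 t.1.2 t.2.

Lemma quat_to_prodK : cancel quat_to_prod quat_of_prod.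
Proof. by case. Qed.

HB.instance Definition _ := Choice.copy H (can_type quat_to_prodK).

Definition quat_zero : H := Quaternion 0 0 0 0.
Definition quat_opp x := Quaternion (- q0 x) (- q1 x) (- q2 x) (- q3 x).
Definition quat_add x y :=
  Quaternion (q0 x + q0 y) (q1 x + q1 y) (q2 x + q2 y) (q3 x + q3 y).

Lemma quat_addA : associative quat_add.
Proof. by move=> x y z; congr Quaternion; rewrite /= addrA. Qed.
Lemma quat_addC : commutative quat_add.
Proof. by move=> x y; congr Quaternion; rewrite addrC. Qed.
Lemma quat_add0 : left_id quat_zero quat_add.
Proof. by case=> *; congr Quaternion; rewrite /= add0r. Qed.
Lemma quat_addN : left_inverse quat_zero quat_opp quat_add.
Proof. by move=> x; congr Quaternion; rewrite /= addNr. Qed.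

HB.instance Definition _ :=
  GRing.isZmodule.Build H quat_addA quat_addC quat_add0 quat_addN.

Definition quat_one : H := Quaternion 1 0 0 0.
Definition quat_mul x y := Quaternion
  (q0 x * q0 y - q1 x * q1 y - q2 x * q2 y - q3 x * q3 y)
  (q0 x * q1 y + q1 x * q0 y + q2 x * q3 y - q3 x * q2 y)
  (q0 x * q2 y - q1 x * q3 y + q2 x * q0 y + q3 x * q1 y)
  (q0 x * q3 y + q1 x * q2 y - q2 x * q1 y + q3 x * q0 y).

Lemma quat_mulA : associative quat_mul.
Proof. by move=> x y z; congr Quaternion; rewrite /=; ring. Qed.
Lemma quat_mul1l : left_id quat_one quat_mul.
Proof. by case=> *; congr Quaternion; rewrite /=; ring. Qed.
Lemma quat_mul1r : right_id quat_one quat_mul.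
Proof. by case=> *; congr Quaternion; rewrite /=; ring. Qed.
Lemma quat_mulDl : left_distributive quat_mul quat_add.
Proof. by move=> x y z; congr Quaternion; rewrite /=; ring. Qed.
Lemma quat_mulDr : right_distributive quat_mul quat_add.
Proof. by move=> x y z; congr Quaternion; rewrite /=; ring. Qed.
Lemma quat_one_neq0 : quat_one != 0.
Proof. by apply/eqP => -[] /eqP; rewrite oner_eq0. Qed.

HB.instance Definition _ := GRing.Zmodule_isNzRing.Build H
  quat_mulA quat_mul1l quat_mul1r quat_mulDl quat_mulDr quat_one_neq0.

Definition quat_scale (k : R) x :=
  Quaternion (k * q0 x) (k * q1 x) (k * q2 x) (k * q3 x).

Lemma quat_scaleA k l x : quat_scale k (quat_scale l x) = quat_scale (k * l) x.
Proof. by congr Quaternion; rewrite /= mulrA. Qed.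
Lemma quat_scale1 : left_id 1 quat_scale.
Proof. by case=> *; congr Quaternion; rewrite /= mul1r. Qed.
Lemma quat_scaleDr : right_distributive quat_scale +%R.
Proof. by move=> k x y; congr Quaternion; rewrite /= mulrDr. Qed.
Lemma quat_scaleDl x : {morph quat_scale^~ x : k l / k + l}.
Proof. by move=> k l; congr Quaternion; rewrite /= mulrDl. Qed.

HB.instance Definition _ := GRing.Zmodule_isLmodule.Build R H
  quat_scaleA quat_scale1 quat_scaleDr quat_scaleDl.

Lemma quat_scaleAl (k : R) x y : k *: (x * y) = (k *: x) * y.
Proof. by congr Quaternion; rewrite /=; ring. Qed.
HB.instance Definition _ := GRing.Lmodule_isLalgebra.Build R H quat_scaleAl.

Lemma quat_scaleAr (k : R) x y : k *: (x * y) = x * (k *: y).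
Proof. by congr Quaternion; rewrite /=; ring. Qed.
HB.instance Definition _ := GRing.Lalgebra_isAlgebra.Build R H quat_scaleAr.

Definition quat_norm x : R :=
  Num.sqrt (q0 x ^+ 2 + q1 x ^+ 2 + q2 x ^+ 2 + q3 x ^+ 2).

Lemma quat_sqnorm_ge0 x : 0 <= q0 x ^+ 2 + q1 x ^+ 2 + q2 x ^+ 2 + q3 x ^+ 2.
Proof. by rewrite !addr_ge0 ?sqr_ge0. Qed.

Lemma quat_normD x y : quat_norm (x + y) <= quat_norm x + quat_norm y.
Proof.
rewrite -ler_sqr ?nnegrE ?addr_ge0 ?sqrtr_ge0// sqrrD.
rewrite !sqr_sqrtr ?quat_sqnorm_ge0//.
set d := q0 x * q0 y + q1 x * q1 y + q2 x * q2 y + q3 x * q3 y.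
have d_le : d <= quat_norm x * quat_norm y.
  rewrite -sqrtrM ?quat_sqnorm_ge0//.
  apply: (le_trans (ler_norm d)); rewrite -sqrtr_sqr ler_wsqrtr// /d -subr_ge0.
  rewrite [leRHS](_ : _ =
      (q0 x * q1 y - q1 x * q0 y) ^+ 2 + (q0 x * q2 y - q2 x * q0 y) ^+ 2 +
      (q0 x * q3 y - q3 x * q0 y) ^+ 2 + (q1 x * q2 y - q2 x * q1 y) ^+ 2 +
      (q1 x * q3 y - q3 x * q1 y) ^+ 2 + (q2 x * q3 y - q3 x * q2 y) ^+ 2).
    by rewrite !addr_ge0 ?sqr_ge0.
  by ring.
by move: d_le; rewrite /d /quat_norm /=; lra.
Qed.

Lemma quat_normZ (k : R) x : quat_norm (k *: x) = `|k| * quat_norm x.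
Proof.
rewrite /quat_norm -sqrtr_sqr -sqrtrM ?sqr_ge0//; congr Num.sqrt => /=.
by ring.
Qed.

Lemma quat_norm_eq0 x : quat_norm x = 0 -> x = 0.
Proof.
move/eqP; rewrite sqrtr_eq0 => le0.
have := quat_sqnorm_ge0 x; rewrite le_eqVlt ltNge le0 orbF eq_sym.
rewrite !paddr_eq0 ?addr_ge0 ?sqr_ge0// !sqrf_eq0.
by case: x {le0} => a b c d /= /andP[/andP[/andP[/eqP-> /eqP->] /eqP->] /eqP->].
Qed.

(* The norm [`|q|] is the Euclidean modulus; topology, compactness and
   directional derivatives on quaternions are those of this norm. *)
HB.instance Definition _ := Lmodule_isNormed.Build R H
  quat_normD quat_normZ quat_norm_eq0.

End QuaternionStructures.

Section SliceHyperholomorphic.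
Variable R : realType.
Local Notation H := (quaternion R).
Implicit Types (p q I J : H) (U : set H) (f : H -> H).

Definition e1 : H := Quaternion 0 1 0 0.
Definition e2 : H := Quaternion 0 0 1 0.
Definition e3 : H := Quaternion 0 0 0 1.

Definition qim q : H := Quaternion 0 (q1 q) (q2 q) (q3 q).
Definition qconj q : H := (q0 q)%:A - qim q.

Definition unit_imag : set H := [set I | q0 I = 0 /\ `|I| = 1].

Definition slice I : set H :=
  [set q | exists x y : R, q = x%:A + y *: I].

Definition qclass q : set H :=
  [set (q0 q)%:A + `|qim q| *: I | I in unit_imag].

Definition axially_symmetric U := forall q, U q -> qclass q `<=` U.

Definition slice_domain U : set (R * R) :=
  [set w | forall I, unit_imag I -> U (w.1%:A + w.2 *: I)].

Definition partial_u (g : R * R -> H) : R * R -> H := 'D_(1, 0) g.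
Definition partial_v (g : R * R -> H) : R * R -> H := 'D_(0, 1) g.

Definition C1_on (W : set (R * R)) (g : R * R -> H) := forall w, W w ->
  [/\ derivable g w (1, 0), derivable g w (0, 1),
      {for w, continuous (partial_u g)} & {for w, continuous (partial_v g)}].

(* Functions on [U] and on [slice_domain U] are total functions of which only
   the values on these (open) sets matter. *)
Definition slice_hyperholomorphic U f :=
  exists alpha beta : R * R -> H,
  [/\ C1_on (slice_domain U) alpha /\ C1_on (slice_domain U) beta,
      forall u v, slice_domain U (u, v) ->
        alpha (u, - v) = alpha (u, v) /\ beta (u, - v) = - beta (u, v),
      forall w, slice_domain U w ->
        partial_u alpha w = partial_v beta w /\
        partial_v alpha w = - partial_u beta w
    & forall u v I, slice_domain U (u, v) -> unit_imag I ->
        f (u%:A + v *: I) = alpha (u, v) + I * beta (u, v)].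

(* [D f = d_{q0} f + e1 d_{q1} f + e2 d_{q2} f + e3 d_{q3} f]; the library's
   ['D_v f q] is only meaningful under [has_partials f q]. *)
Definition has_partials f q :=
  [/\ derivable f q 1, derivable f q e1, derivable f q e2 & derivable f q e3].

Definition Dirac f q : H :=
  'D_1 f q + e1 * 'D_e1 f q + e2 * 'D_e2 f q + e3 * 'D_e3 f q.

Definition slice_disc I p (r : \bar R) : set H :=
  slice I `&` [set z | (`|z - p|%:E < r)%E].

(* The radius may be [+oo]. All admissible [I] give the same set: [I] is
   determined up to sign if [p] is not real, and for real [p] the condition on
   [x], [y] does not depend on [I]. *)
Definition Omega p (r : \bar R) : set H :=
  [set q | exists I J (x y : R),
    [/\ unit_imag I /\ slice I p, unit_imag J,
        slice_disc I p r (x%:A + y *: I),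
        slice_disc I p r (x%:A - y *: I) & q = x%:A + y *: J]].

Definition star_pow q p m : H :=
  \sum_(i < m.+1) (q ^+ i * (- p) ^+ (m - i)) *+ 'C(m, i).

(* [(q - p)^{*m} * (qbar - p)^{*k}] *)
Definition star_pow_mul q p m k : H :=
  \sum_(i < m.+1) \sum_(j < k.+1)
    (q ^+ i * qconj q ^+ j * (- p) ^+ (m - i + (k - j)))
      *+ ('C(m, i) * 'C(k, j)).

Definition Htilde n q p : H :=
  n.+1%:R^-1 *: \sum_(1 <= k < n.+2) star_pow_mul q p (n.+1 - k) (k - 1).

Definition star_taylor_term (a : nat -> H) p (n : nat) q : H :=
  star_pow q p n * a n.

Definition star_taylor_on (A : set H) f p (a : nat -> H) :=
  forall K : set H, compact K -> K `<=` A ->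
    (forall q, K q -> cvgn [normed series (star_taylor_term a p ^~ q)]) /\
    {uniform K, (fun N q => series (star_taylor_term a p ^~ q) N) @ \oo --> f}.

Definition root_limsup (a : nat -> H) : \bar R :=
  limn_esup (fun n => (`|a n| `^ n%:R^-1)%:E).

End SliceHyperholomorphic.

Arguments e1 {R}.
Arguments e2 {R}.
Arguments e3 {R}.

(* Main.v *)
(* Write [q = u + v J], choose [I] with [p] in [C_I], and put [z = u + v I],
   [A = z - p] and [B = zbar - p]; [A] and [B] commute.  The representation
   formula for slice functions turns star powers into ordinary powers of [A]
   and [B]; it gives [(n + 1) Htilde_n = sum_i A^(n-i) B^i], and hence
   [(q-p)^{*(n+1)} - (qbar-p)^{*(n+1)} = 2 v (n + 1) J Htilde_n].
   If [v <> 0], the Cauchy-Riemann equations reduce [D f] to [-2 beta / v],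
   that is to [J (f q - f qbar) / v], so subtracting the expansions of [f] at
   [q] and [qbar] already yields the series: only pointwise convergence is
   needed.  If [q] is real, then [D f = -2 (d/dq_0) f] and
   [Htilde_n = (q - p)^n], and the star expansion has to be differentiated
   termwise along the real axis; absolute convergence at a real point of
   [Omega] farther from [p] than [q] provides the domination. *)
Require Import Defs.
From HB Require Import structures.
From mathcomp Require Import all_boot all_order all_algebra.
From mathcomp Require Import ring lra.
From mathcomp Require Import all_classical all_reals all_analysis.

Import Order.TTheory GRing.Theory Num.Theory.
Import numFieldNormedType.Exports.
Local Open Scope classical_set_scope.
Local Open Scope ring_scope.

Set Implicit Arguments.
Unset Strict Implicit.
Unset Printing Implicit Defensive.

(** * Quaternion algebra, the representation formula and star powers *)

Section QuaternionAlgebra.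
Variable R : realType.
Local Notation H := (quaternion R).
Implicit Types (x y : H) (I J K : H) (s t u v : R).

Lemma quat_eqP x y :
  q0 x = q0 y -> q1 x = q1 y -> q2 x = q2 y -> q3 x = q3 y -> x = y.
Proof. by case: x y => ? ? ? ? [? ? ? ?] /= -> -> -> ->. Qed.

Lemma quat_normE x :
  `|x| = Num.sqrt (q0 x ^+ 2 + q1 x ^+ 2 + q2 x ^+ 2 + q3 x ^+ 2).
Proof. by []. Qed.

Lemma quat_sqr_norm x :
  `|x| ^+ 2 = q0 x ^+ 2 + q1 x ^+ 2 + q2 x ^+ 2 + q3 x ^+ 2.
Proof. by rewrite quat_normE sqr_sqrtr ?quat_sqnorm_ge0. Qed.

Lemma quat_normM x y : `|x * y| = `|x| * `|y|.
Proof.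
rewrite !quat_normE -sqrtrM ?quat_sqnorm_ge0//; congr Num.sqrt => /=; ring.
Qed.

Lemma quat_normX x n : `|x ^+ n| = `|x| ^+ n.
Proof.
elim: n => [|n IH]; last by rewrite !exprS quat_normM IH.
by rewrite !expr0 quat_normE /= expr1n expr0n/= !addr0 sqrtr1.
Qed.

Lemma unit_imag_sqr J : unit_imag J -> J * J = -1.
Proof.
move=> [J0 J1]; have := quat_sqr_norm J; rewrite J0 J1 expr1n => e.
by apply: quat_eqP; rewrite /= J0; nra.
Qed.

Lemma unit_imagN J : unit_imag J -> unit_imag (- J).
Proof. by move=> [J0 J1]; split; rewrite ?normrN //= J0 oppr0. Qed.

Lemma unit_imagP J : q0 J = 0 -> q1 J ^+ 2 + q2 J ^+ 2 + q3 J ^+ 2 = 1 ->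
  unit_imag J.
Proof.
by move=> J0 J1; split=> //; rewrite quat_normE J0 expr0n /= add0r J1 sqrtr1.
Qed.

Lemma unit_imag_e1 : unit_imag (e1 : H).
Proof. by apply: unit_imagP => //=; ring. Qed.

Lemma unit_imag_e2 : unit_imag (e2 : H).
Proof. by apply: unit_imagP => //=; ring. Qed.

Lemma unit_imag_e3 : unit_imag (e3 : H).
Proof. by apply: unit_imagP => //=; ring. Qed.

Lemma qconj_slice u v J : unit_imag J ->
  qconj (u%:A + v *: J) = u%:A - v *: J.
Proof. by move=> [J0 _]; apply: quat_eqP => /=; rewrite ?J0; ring. Qed.

Lemma slice_comm I x y : slice I x -> slice I y -> GRing.comm x y.
Proof.
by move=> [s [t ->]] [u [v ->]]; apply: quat_eqP => /=; ring.
Qed.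

Lemma slice_sub_comm u v I p : slice I p ->
  GRing.comm (u%:A + v *: I - p) (u%:A - v *: I - p).
Proof.
move=> [s [t ->]]; apply: (@slice_comm I).
  by exists (u - s), (v - t); apply: quat_eqP => /=; ring.
by exists (u - s), (- v - t); apply: quat_eqP => /=; ring.
Qed.

(** Since [J * J = -1] for every unit [J], all planes [C_J] multiply by the same real formulas, so
    [s] and [t] can be chosen before [J]. *)
Lemma slice_monomialE u v i j : exists s t, forall J, unit_imag J ->
  (u%:A + v *: J) ^+ i * (u%:A - v *: J) ^+ j = s%:A + t *: J.
Proof.
have mul_slice c d s t J : unit_imag J ->
    (c%:A + d *: J) * (s%:A + t *: J) =
    (c * s - d * t)%:A + (c * t + d * s) *: J.
  move=> /unit_imag_sqr JJ.
  rewrite mulrDl !mulrDr -!scalerAl !mul1r -!scalerAr JJ mulr1 !scalerA.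
  by apply: quat_eqP => /=; ring.
elim: i => [|i [s [t IH]]].
  elim: j => [|j [s [t IH]]].
    by exists 1, 0 => J _; rewrite !expr0 mul1r scale1r scale0r addr0.
  exists (u * s - (- v) * t), (u * t + (- v) * s) => J uJ.
  by rewrite expr0 mul1r exprS -mul_slice// -IH// expr0 mul1r scaleNr.
exists (u * s - v * t), (u * t + v * s) => J uJ.
by rewrite exprS -mulrA IH// mul_slice.
Qed.

(** The value is [s + t J] with [s], [t] independent of the unit. The values at [I] and [-I], which
    exchange [z] and [zc], determine [s] and [t]. *)
Lemma slice_monomial_repr u v I J i j : unit_imag I -> unit_imag J ->
  let q := u%:A + v *: J in
  let z := u%:A + v *: I in let zc := u%:A - v *: I in
  q ^+ i * qconj q ^+ j = 2^-1 *: ((1 - J * I) * (z ^+ i * zc ^+ j))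
    + 2^-1 *: ((1 + J * I) * (zc ^+ i * z ^+ j)).
Proof.
move=> uI uJ q z zc; have [s [t E]] := slice_monomialE u v i j.
rewrite /q qconj_slice// E// /z /zc E//.
have := E _ (unit_imagN uI); rewrite !scalerN opprK => ->.
have II := unit_imag_sqr uI.
rewrite -scalerDr !mulrDr !mulrDl !mulNr !mulrN !mul1r.
rewrite -!scalerAr -!mulrA II !mulr1 mulrN1.
by apply: quat_eqP => /=; field.
Qed.

Lemma exprB_comm_sum (x y : H) m : GRing.comm x y ->
  (x - y) ^+ m = \sum_(i < m.+1) (x ^+ i * (- y) ^+ (m - i)) *+ 'C(m, i).
Proof.
move=> xy; have /commrN xNy := xy; rewrite addrC exprDn_comm; last exact: commr_sym.
by apply: eq_bigr => i _; congr (_ *+ _); apply/commrX/commr_sym/commrX.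
Qed.

(** The right-hand side is the expansion in [star_pow_mul]: when the variables commute with the
    center, star products are ordinary products. *)
Lemma exprB_mul_comm_sum (x x' y : H) m k :
  GRing.comm x y -> GRing.comm x' y ->
  (x - y) ^+ m * (x' - y) ^+ k =
  \sum_(i < m.+1) \sum_(j < k.+1)
    (x ^+ i * x' ^+ j * (- y) ^+ (m - i + (k - j))) *+ ('C(m, i) * 'C(k, j)).
Proof.
move=> xy xy'; rewrite !exprB_comm_sum// big_distrl; apply: eq_bigr => i _ /=.
rewrite big_distrr; apply: eq_bigr => j _ /=.
rewrite mulrnAl mulrnAr -mulrnA mulnC; congr (_ *+ _).
rewrite exprD -!mulrA; congr (_ * _); rewrite !mulrA; congr (_ * _).
by apply/commr_sym/commrX/commrN/commr_sym/commrX/commr_sym.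
Qed.

Lemma sum_expr_comm_rev (x y : H) n : GRing.comm x y ->
  \sum_(i < n.+1) y ^+ (n - i) * x ^+ i = \sum_(i < n.+1) x ^+ (n - i) * y ^+ i.
Proof.
move=> xy; rewrite (reindex_inj rev_ord_inj) /=; apply: eq_bigr => i _.
rewrite subSS subKn; last by rewrite -ltnS.
by apply/commrX/commr_sym/commrX.
Qed.

Lemma half_sub_add (x y : H) :
  2^-1 *: ((1 - x) * y) + 2^-1 *: ((1 + x) * y) = y.
Proof. by apply: quat_eqP => /=; field. Qed.

Section Representation.
Variables (u v : R) (I J p : H).
Hypotheses (uI : unit_imag I) (uJ : unit_imag J) (Ip : slice I p).
Let q := u%:A + v *: J.
Let A := u%:A + v *: I - p.
Let B := u%:A - v *: I - p.

Let comm_zp : GRing.comm (u%:A + v *: I) p.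
Proof. by apply: slice_comm Ip; exists u, v. Qed.

Let comm_zcp : GRing.comm (u%:A - v *: I) p.
Proof. by apply: slice_comm Ip; exists u, (- v); rewrite scaleNr. Qed.

Let comm_AB : GRing.comm A B.
Proof. exact: slice_sub_comm. Qed.

(** Powers of [p] stand to the right of each monomial in [q] and its conjugate, so the
    representation formula applies term by term. In [C_I] everything commutes, and the sums close up
    to powers of [A] and [B]. *)
Lemma star_pow_mul_repr m k : star_pow_mul q p m k =
  2^-1 *: ((1 - J * I) * (A ^+ m * B ^+ k))
  + 2^-1 *: ((1 + J * I) * (B ^+ m * A ^+ k)).
Proof.
rewrite /A /B !exprB_mul_comm_sum// !big_distrr /= !scaler_sumr -big_split /=.
apply: eq_bigr => i _; rewrite !big_distrr /= !scaler_sumr -big_split /=.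
apply: eq_bigr => j _.
rewrite ![in RHS]mulrnAr -!scalerMnr -mulrnDl; congr (_ *+ _).
rewrite !mulrA !scalerAl -mulrDl; congr (_ * _).
by rewrite /q (slice_monomial_repr u v i j uI uJ) !mulrA !scalerAl.
Qed.

Lemma star_pow_mul0 m : star_pow q p m = star_pow_mul q p m 0.
Proof.
apply: eq_bigr => i _; rewrite big_ord1 bin0 muln1 expr0 mulr1.
by rewrite subn0 addn0.
Qed.

Lemma star_pow_repr m : star_pow q p m =
  2^-1 *: ((1 - J * I) * A ^+ m) + 2^-1 *: ((1 + J * I) * B ^+ m).
Proof. by rewrite star_pow_mul0 star_pow_mul_repr !expr0 !mulr1. Qed.

(* The two halves of the representation formula carry the same sum, because
   exchanging [A] and [B] reverses the order of its terms. *)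
Lemma Htilde_repr n : n.+1%:R *: Htilde n q p =
  \sum_(i < n.+1) A ^+ (n - i) * B ^+ i.
Proof.
rewrite /Htilde scalerA divff ?pnatr_eq0// scale1r.
rewrite big_add1 /= big_mkord.
have -> : \sum_(i < n.+1) star_pow_mul q p (n.+1 - i.+1) (i.+1 - 1) =
  \sum_(i < n.+1) star_pow_mul q p (n - i) i.
  by apply: eq_bigr => i _; rewrite subSS subn1.
rewrite (eq_bigr _ (fun i _ => star_pow_mul_repr _ _)).
rewrite big_split /= -!scaler_sumr -!big_distrr /=.
by rewrite (sum_expr_comm_rev n comm_AB) half_sub_add.
Qed.

End Representation.

(** The conjugate point belongs to the unit [-J] with the same [A] and [B], so the difference is
    [- (J * I)] times [A ^+ n.+1 - B ^+ n.+1]. This factors through [A - B = (2 * v) *: I], and the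
    cofactor is the sum in [Htilde_repr]. *)
Lemma star_pow_conj_sub u v I J p n :
  unit_imag I -> unit_imag J -> slice I p ->
  star_pow (u%:A + v *: J) p n.+1 - star_pow (u%:A - v *: J) p n.+1 =
  (2 * v * n.+1%:R) *: (J * Htilde n (u%:A + v *: J) p).
Proof.
move=> uI uJ Ip.
rewrite (star_pow_repr u v uI uJ Ip).
have := star_pow_repr u v uI (unit_imagN uJ) Ip n.+1; rewrite scalerN => ->.
rewrite -[in RHS]scalerA [in RHS]scalerAr (Htilde_repr u v uI uJ Ip) mulNr opprK.
set A := _ + _ - p; set B := _ - _ - p.
have AB : GRing.comm A B by exact: slice_sub_comm.
rewrite [LHS](_ : _ = - (J * I) * (A ^+ n.+1 - B ^+ n.+1)); last first.
  by move: (A ^+ _) (B ^+ _) (J * I) => C D K; apply: quat_eqP => /=; field.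
rewrite subrXX_comm//= (_ : A - B = (2 * v) *: I); last first.
  by rewrite /A /B; apply: quat_eqP => /=; ring.
rewrite -scalerAl -scalerAr mulNr !mulrA -[J * I * I]mulrA unit_imag_sqr//.
by rewrite mulrN1 mulNr opprK.
Qed.

End QuaternionAlgebra.

(** * Limits of quaternion-valued functions through coordinates *)

Section QuaternionLimits.
Variable R : realType.
Local Notation H := (quaternion R).
Implicit Types (x y : H).

Lemma quat_coord_norm_le x :
  [/\ `|q0 x| <= `|x|, `|q1 x| <= `|x|, `|q2 x| <= `|x| & `|q3 x| <= `|x|].
Proof.
have le s : 0 <= s -> s <= `|x| ^+ 2 -> Num.sqrt s <= `|x|.
  by move=> s0 sx; rewrite -ler_sqr ?nnegrE ?sqrtr_ge0// sqr_sqrtr.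
by split; rewrite -sqrtr_sqr; apply: le; rewrite ?quat_sqr_norm; nra.
Qed.

Lemma quat_decomp x :
  x = q0 x *: 1 + q1 x *: e1 + q2 x *: e2 + q3 x *: e3.
Proof. by apply: quat_eqP => /=; ring. Qed.

Lemma cvg_quatP (T : Type) (F : set_system T) {FF : Filter F}
    (g : T -> H) (l : H) :
  g x @[x --> F] --> l <->
  [/\ q0 (g x) @[x --> F] --> q0 l, q1 (g x) @[x --> F] --> q1 l,
      q2 (g x) @[x --> F] --> q2 l & q3 (g x) @[x --> F] --> q3 l].
Proof.
split=> [gl|[g0 g1 g2 g3]].
  have gle (e : R) : 0 < e -> \forall t \near F, `|l - g t| <= e.
    by move: e; apply/cvgrPdist_le.
  split; apply/cvgrPdist_le => e /gle; apply: filterS => t; apply: le_trans;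
    by case: (quat_coord_norm_le (l - g t)).
rewrite (quat_decomp l) (_ : g = fun t => q0 (g t) *: 1 + q1 (g t) *: e1
    + q2 (g t) *: e2 + q3 (g t) *: e3); last by apply/funext=> t; exact: quat_decomp.
by apply: cvgD; [apply: cvgD; [apply: cvgD|]|]; apply: cvgZr_tmp.
Qed.

Lemma cvg_quatM (T : Type) (F : set_system T) {FF : Filter F}
    (f g : T -> H) (k l : H) :
  f x @[x --> F] --> k -> g x @[x --> F] --> l ->
  f x * g x @[x --> F] --> k * l.
Proof.
move=> /cvg_quatP[f0 f1 f2 f3] /cvg_quatP[g0 g1 g2 g3]; apply/cvg_quatP.
by split=> /=; repeat first [exact: cvgM|apply: cvgB|apply: cvgD].
Qed.

Lemma cvg_quatX (T : Type) (F : set_system T) {FF : Filter F}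
    (f : T -> H) (k : H) n :
  f x @[x --> F] --> k -> f x ^+ n @[x --> F] --> k ^+ n.
Proof.
move=> fk; elim: n => [|n IH]; first by under eq_fun do rewrite expr0; exact: cvg_cst.
rewrite exprS (_ : (fun t => f t ^+ n.+1) = fun t => f t * f t ^+ n).
  exact: cvg_quatM.
by apply/funext => t; rewrite exprS.
Qed.

Lemma cvg_quat_sum (T I : Type) (F : set_system T) {FF : Filter F} (r : seq I)
    (f : I -> T -> H) (k : I -> H) :
  (forall i, f i x @[x --> F] --> k i) ->
  \sum_(i <- r) f i x @[x --> F] --> \sum_(i <- r) k i.
Proof.
move=> fk; elim: r => [|i r IH].
  by under eq_fun do rewrite big_nil; rewrite big_nil; exact: cvg_cst.
under eq_fun do rewrite big_cons.
by rewrite big_cons; apply: cvgD.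
Qed.

End QuaternionLimits.

(** * Directional derivatives as derivatives along lines *)

Lemma is_deriveE (R : realType) (V W : normedModType R) (f : V -> W)
    (a v : V) (d : W) : is_derive a v f d <->
  h^-1 *: (f (h *: v + a) - f a) @[h --> 0^'] --> d.
Proof.
split=> [[ex <-]|c]; first exact: ex.
by apply: DeriveDef; [apply/cvg_ex; exists d|exact: cvg_lim].
Qed.

(** The base parameter [t] is free, so that [s] can later be the moving coordinate of the point
    itself. *)
Lemma is_derive_line (R : realType) (V W : normedModType R) (f : V -> W)
    (a v : V) (d : W) (t : R) :
  is_derive t 1 (fun s : R => f (a + (s - t) *: v)) d <-> is_derive a v f d.
Proof.
suff E : (fun h : R => h^-1 *: (f (a + (h *: 1 + t - t) *: v) - f (a + (t - t) *: v)))
    = fun h => h^-1 *: (f (h *: v + a) - f a).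
  by split=> /is_deriveE c; apply/is_deriveE; move: c; rewrite E.
apply/funext => h; rewrite addrK subrr scale0r addr0 [h *: v + a]addrC.
by rewrite (_ : h *: (1 : R) = h) // -[LHS]/(h * 1) mulr1.
Qed.

Section QuaternionDerivatives.
Variable R : realType.
Local Notation H := (quaternion R).

Lemma is_derive_quatP (V : normedModType R) (g : V -> H) (a v : V) (d : H) :
  is_derive a v g d <->
  [/\ is_derive a v (fun x => q0 (g x)) (q0 d),
      is_derive a v (fun x => q1 (g x)) (q1 d),
      is_derive a v (fun x => q2 (g x)) (q2 d) &
      is_derive a v (fun x => q3 (g x)) (q3 d)].
Proof.
split=> [/is_deriveE/cvg_quatP[/= c0 c1 c2 c3]|].
  by split; apply/is_deriveE.
move=> [/is_deriveE c0 /is_deriveE c1 /is_deriveE c2 /is_deriveE c3].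
by apply/is_deriveE/cvg_quatP; split.
Qed.

Lemma partial_u_is_derive (g : R * R -> H) u v :
  derivable g (u, v) (1, 0) ->
  is_derive u 1 (fun s => g (s, v)) (partial_u g (u, v)).
Proof.
move=> /derivableP gu; rewrite (_ : (fun s => _) =
    fun s => g ((u, v) + (s - u) *: (1, 0))); first exact/is_derive_line.
apply/funext => s; congr g; congr pair; rewrite /=.
  by rewrite -[_ *: _]/(_ * _) mulr1 addrC subrK.
by rewrite scaler0 addr0.
Qed.

Lemma partial_v_is_derive (g : R * R -> H) u v :
  derivable g (u, v) (0, 1) ->
  is_derive v 1 (fun s => g (u, s)) (partial_v g (u, v)).
Proof.
move=> /derivableP gv; rewrite (_ : (fun s => _) =
    fun s => g ((u, v) + (s - v) *: (0, 1))); first exact/is_derive_line.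
apply/funext => s; congr g; congr pair; rewrite /=.
  by rewrite scaler0 addr0.
by rewrite -[_ *: _]/(_ * _) mulr1 addrC subrK.
Qed.

End QuaternionDerivatives.

(** * Product and chain rules, derivative of the modulus *)

Section QuaternionDerivativeRules.
Variable R : realType.
Local Notation H := (quaternion R).

Lemma is_derive_quatM (V : normedModType R) (f g : V -> H) (a v : V)
    (df dg : H) :
  is_derive a v f df -> is_derive a v g dg ->
  is_derive a v (fun x => f x * g x) (f a * dg + df * g a).
Proof.
move=> /is_deriveE fd /is_deriveE gd; apply/is_deriveE.
(* A directional derivative yields continuity along its line: the increment of [f] is [h] times a
   convergent quotient. *)
have fc : f (h *: v + a) @[h --> 0^'] --> f a.
  have c : f a + h *: (h^-1 *: (f (h *: v + a) - f a)) @[h --> 0^']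
      --> f a + (0 : R) *: df.
    apply: cvgD; first exact: cvg_cst.
    by apply: cvgZ => //; apply: cvg_within.
  rewrite scale0r addr0 in c; apply: cvg_trans c; apply: near_eq_cvg.
  near=> h; rewrite scalerA divff ?scale1r; last by near: h; exact: nbhs_dnbhs_neq.
  by rewrite addrC subrK.
rewrite (_ : (fun h => _) = fun h =>
    f (h *: v + a) * (h^-1 *: (g (h *: v + a) - g a)) +
    (h^-1 *: (f (h *: v + a) - f a)) * g a).
  by apply: cvgD; apply: cvg_quatM => //; exact: cvg_cst.
apply/funext => h; rewrite -scalerAr -scalerAl -scalerDr mulrBr mulrBl.
by rewrite addrA subrK.
Unshelve. all: by end_near. Qed.

Lemma is_derive_quat_alg (V : normedModType R) (k : V -> R) (a v : V) (dk : R) :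
  is_derive a v k dk -> is_derive a v (fun x => (k x)%:A : H) dk%:A.
Proof.
move=> /is_deriveE kd; apply/is_deriveE.
rewrite (_ : (fun h => _) = fun h =>
    (h^-1 *: (k (h *: v + a) - k a)) *: (1 : H)); first exact: cvgZr_tmp.
by apply/funext => h; rewrite -scalerBl scalerA.
Qed.

Lemma is_derive_quat_comp (A : R -> H) (phi : R -> R) (t dphi : R) (dA : H) :
  is_derive (phi t) 1 A dA -> is_derive t 1 phi dphi ->
  is_derive t 1 (fun s => A (phi s)) (dphi *: dA).
Proof.
move=> /is_derive_quatP[d0 d1 d2 d3] dp; apply/is_derive_quatP.
by split; apply: is_derive_eq (is_derive1_comp _ dp) _; rewrite 1?mulrC.
Qed.

(** Along an imaginary coordinate line the modulus of the imaginary part has this form, [c] being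
    the sum of the squares of the two fixed coordinates. *)
Lemma is_derive_sqrt_sqr (c m : R) : 0 < c + m ^+ 2 ->
  is_derive m 1 (fun s => Num.sqrt (c + s ^+ 2)) (m / Num.sqrt (c + m ^+ 2)).
Proof.
move=> cm0.
have dP : is_derive m 1 (fun s : R => c + s ^+ 2) (2 * m).
  have d := is_deriveD (is_derive_cst c m 1) (is_deriveX 2 (is_derive_id m 1)).
  rewrite (_ : (fun s => _) = cst c + id ^+ 2); last exact/funext.
  by apply: is_derive_eq d _; rewrite /= add0r expr1 -[_ *: _]/(_ * _) mulr1.
apply: is_derive_eq (@is_derive1_comp _ Num.sqrt (fun s => c + s ^+ 2) m _ _
  (is_derive1_sqrt cm0) dP) _.
have := sqrtr_gt0 (c + m ^+ 2); rewrite cm0 => /lt0r_neq0 ?.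
by field.
Qed.

End QuaternionDerivativeRules.

(** * The Dirac operator on slice hyperholomorphic functions *)

Section DiracSlice.
Variable R : realType.
Local Notation H := (quaternion R).
Variables (U : set H) (f : H -> H) (alpha beta : R * R -> H).
Hypotheses (openU : open U) (symU : axially_symmetric U).
Hypothesis C1alpha : C1_on (slice_domain U) alpha.
Hypothesis C1beta : C1_on (slice_domain U) beta.
Hypothesis parity : forall u v, slice_domain U (u, v) ->
  alpha (u, - v) = alpha (u, v) /\ beta (u, - v) = - beta (u, v).
Hypothesis cauchy_riemann : forall w, slice_domain U w ->
  partial_u alpha w = partial_v beta w /\
  partial_v alpha w = - partial_u beta w.
Hypothesis sliceE : forall u v I, slice_domain U (u, v) -> unit_imag I ->
  f (u%:A + v *: I) = alpha (u, v) + I * beta (u, v).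

Lemma slice_domain_point q : U q -> slice_domain U (q0 q, `|qim q|).
Proof. by move=> Uq I uI; apply: symU Uq _ _; exists I. Qed.

Lemma slice_domain_normr u s :
  slice_domain U (u, `|s|) -> slice_domain U (u, s).
Proof.
move=> + I uI; have [_|_] := ger0P s; first exact.
by move=> /(_ _ (unit_imagN uI)) /=; rewrite scalerN scaleNr opprK.
Qed.

Lemma slice_beta0 u : slice_domain U (u, 0) -> beta (u, 0) = 0.
Proof.
move=> /parity[_]; rewrite oppr0 => /eqP; rewrite -addr_eq0 -mulr2n.
by rewrite -scaler_nat scaler_eq0 pnatr_eq0 => /eqP.
Qed.

(** This describes [f] without choosing a unit. At real points [0^-1 = 0] removes the second term,
    consistently with [beta (u, 0) = 0]. *)
Lemma slice_pointE q : U q -> f q =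
  alpha (q0 q, `|qim q|) + `|qim q|^-1 *: (qim q * beta (q0 q, `|qim q|)).
Proof.
move=> /slice_domain_point; have [q00|q_neq0] := eqVneq (qim q) 0.
  rewrite q00 normr0 => dom; rewrite mul0r scaler0 addr0.
  (* A real point determines no unit; [e1] is an arbitrary choice. *)
  rewrite -[RHS]addr0 -(mulr0 e1) -(slice_beta0 dom) -sliceE//.
    congr f; apply: quat_eqP; rewrite /= ?mulr1 ?mulr0 ?mul0r ?addr0//.
    - by case: q00.
    - by case: q00.
    - by case: q00.
  exact: unit_imag_e1.
move=> dom; rewrite scalerAl -sliceE//.
  rewrite scalerA divff ?normr_eq0// scale1r; congr f.
  by apply: quat_eqP => /=; ring.
split; first by rewrite /= mulr0.
by rewrite normrZ normfV normr_id mulVf// normr_eq0.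
Qed.

Lemma near_line (q e : H) (t : R) : U q -> \forall s \near t, U (q + (s - t) *: e).
Proof.
move=> Uq; have c : q + (s - t) *: e @[s --> t] --> q + (t - t) *: e.
  apply: cvgD; first exact: cvg_cst.
  by apply: cvgZr_tmp; apply: cvgB; [exact: cvg_id|exact: cvg_cst].
by apply: c; rewrite subrr scale0r addr0; exact: open_nbhs_nbhs.
Qed.

Lemma qim_norm (q : H) : `|qim q| = Num.sqrt (q1 q ^+ 2 + q2 q ^+ 2 + q3 q ^+ 2).
Proof. by rewrite quat_normE /= expr0n /= add0r. Qed.

Lemma slice_derive_real_dir q : U q ->
  is_derive q 1 f (partial_u alpha (q0 q, `|qim q|)
    + `|qim q|^-1 *: (qim q * partial_u beta (q0 q, `|qim q|))).
Proof.
move=> Uq; apply/(is_derive_line _ _ _ _ (q0 q)).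
set v := `|qim q|.
have [au _ _ _] := C1alpha (slice_domain_point Uq).
have [bu _ _ _] := C1beta (slice_domain_point Uq).
have /partial_u_is_derive da := au; have /partial_u_is_derive db := bu.
apply: (@near_eq_is_derive _ _ _
  (fun s => alpha (s, v) + (v^-1 *: qim q) * beta (s, v))).
  near=> s; rewrite slice_pointE; last by near: s; exact: near_line.
  have -> : q0 (q + (s - q0 q) *: 1) = s by rewrite /=; ring.
  have -> : qim (q + (s - q0 q) *: 1) = qim q.
    by apply: quat_eqP => //=; ring.
  by rewrite scalerAl.
have dm := is_derive_quatM (is_derive_cst (v^-1 *: qim q) (q0 q) (1 : R)) db.
apply: is_derive_eq (is_deriveD da dm) _.
by rewrite mul0r addr0 scalerAl.
Unshelve. all: by end_near. Qed.

(** One computation serves [e1], [e2] and [e3], with [m] the coordinate of [q] along [e]. The four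
    terms come from differentiating [alpha], the imaginary part, the reciprocal modulus and [beta];
    the modulus has derivative [m / v]. *)
Lemma slice_derive_imag_dir q e (c m : R) : U q -> q0 e = 0 -> qim q != 0 ->
  (forall s, `|qim (q + (s - m) *: e)| = Num.sqrt (c + s ^+ 2)) ->
  let v := `|qim q| in
  is_derive q e f ((m / v) *: partial_v alpha (q0 q, v)
    + v^-1 *: (e * beta (q0 q, v))
    - (m / v ^+ 3) *: (qim q * beta (q0 q, v))
    + (m / v ^+ 2) *: (qim q * partial_v beta (q0 q, v))).
Proof.
move=> Uq e0 qn0 phiE v; apply/(is_derive_line _ _ _ _ m).
have v0 : v != 0 by rewrite normr_eq0.
have vE : Num.sqrt (c + m ^+ 2) = v by rewrite -phiE subrr scale0r addr0.
have cm0 : 0 < c + m ^+ 2 by rewrite -sqrtr_gt0 vE normr_gt0.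
have [_ av _ _] := C1alpha (slice_domain_point Uq).
have [_ bv _ _] := C1beta (slice_domain_point Uq).
have /partial_v_is_derive da := av; have /partial_v_is_derive db := bv.
pose phi s := Num.sqrt (c + s ^+ 2).
have dphi : is_derive m 1 phi (m / v) by rewrite -vE; exact: is_derive_sqrt_sqr.
have phim : phi m = v by [].
have dA : is_derive m 1 (fun s => alpha (q0 q, phi s))
    ((m / v) *: partial_v alpha (q0 q, v)).
  by apply: (@is_derive_quat_comp _ (fun t => alpha (q0 q, t))); rewrite ?phim.
have dB : is_derive m 1 (fun s => beta (q0 q, phi s))
    ((m / v) *: partial_v beta (q0 q, v)).
  by apply: (@is_derive_quat_comp _ (fun t => beta (q0 q, t))); rewrite ?phim.
have dV : is_derive m 1 (fun s => (phi s)^-1) (- (m / v ^+ 3)).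
  have phim0 : phi m != 0 by rewrite phim.
  apply: is_derive_eq (is_deriveV phim0 dphi) _.
  by rewrite phim -[_ *: _]/(_ * _); field.
have dQ : is_derive m 1 (fun s => qim q + (s - m) *: e) e.
  apply/(is_derive_line (fun x => x) (qim q) e e m); exact: is_derive_id.
apply: (@near_eq_is_derive _ _ _ (fun s => alpha (q0 q, phi s) +
    (phi s)^-1%:A * ((qim q + (s - m) *: e) * beta (q0 q, phi s)))).
  near=> s; rewrite slice_pointE; last by near: s; exact: near_line.
  have -> : q0 (q + (s - m) *: e) = q0 q by rewrite /= e0; ring.
  rewrite phiE -/(phi s) mulr_algl; congr (_ + _ *: (_ * _)).
  by apply: quat_eqP => //=; rewrite ?e0; ring.
apply: is_derive_eq (is_deriveD dA
  (is_derive_quatM (is_derive_quat_alg dV) (is_derive_quatM dQ dB))) _.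
rewrite phim subrr scale0r addr0.
by apply: quat_eqP => /=; field.
Unshelve. all: by end_near. Qed.

(** The Cauchy-Riemann equations cancel all derivatives of [alpha] and [beta]. The coefficient of
    [beta] is [-3 / v] from the three imaginary directions plus [1 / v] from the reciprocal
    modulus. *)
Lemma Dirac_slice_nonreal q : U q -> qim q != 0 ->
  has_partials f q /\
  Dirac f q = - (2 / `|qim q|) *: beta (q0 q, `|qim q|).
Proof.
move=> Uq qn0; have v0 : `|qim q| != 0 by rewrite normr_eq0.
have d0 := slice_derive_real_dir Uq.
have n1 s : `|qim (q + (s - q1 q) *: e1)| =
    Num.sqrt (q2 q ^+ 2 + q3 q ^+ 2 + s ^+ 2).
  by rewrite qim_norm /=; congr Num.sqrt; ring.
have d1 := slice_derive_imag_dir Uq (erefl : q0 e1 = 0) qn0 n1.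
have n2 s : `|qim (q + (s - q2 q) *: e2)| =
    Num.sqrt (q1 q ^+ 2 + q3 q ^+ 2 + s ^+ 2).
  by rewrite qim_norm /=; congr Num.sqrt; ring.
have d2 := slice_derive_imag_dir Uq (erefl : q0 e2 = 0) qn0 n2.
have n3 s : `|qim (q + (s - q3 q) *: e3)| =
    Num.sqrt (q1 q ^+ 2 + q2 q ^+ 2 + s ^+ 2).
  by rewrite qim_norm /=; congr Num.sqrt; ring.
have d3 := slice_derive_imag_dir Uq (erefl : q0 e3 = 0) qn0 n3.
split; first by split; apply: ex_derive.
rewrite /Dirac !derive_val.
have [] := cauchy_riemann (slice_domain_point Uq).
have v2 : `|qim q| ^+ 2 = q1 q ^+ 2 + q2 q ^+ 2 + q3 q ^+ 2.
  by rewrite quat_sqr_norm /= expr0n /= add0r.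
move: v0 v2; move: `|qim q| => v v0 v2.
have QQ : qim q * qim q = - (v ^+ 2)%:A.
  by rewrite v2; apply: quat_eqP => /=; ring.
move: (beta _) (partial_u alpha _) (partial_v alpha _) => b au av.
move: (partial_u beta _) (partial_v beta _) => bu bv -> ->.
(* Summed over the imaginary directions, the units times the coordinates of [q] give [qim q], and
   the squares of the units give [-3]. *)
transitivity (bv + v^-1 *: (qim q * bu) - v^-1 *: (qim q * bu)
   - v ^- 3 *: (qim q * qim q * b) - (3 / v) *: b
   + v ^- 2 *: (qim q * qim q * bv)).
  by apply: quat_eqP => /=; field.
rewrite QQ; apply: quat_eqP => /=; field => //.
Qed.

(** The derivative in an imaginary unit direction [e] is [e] times the real one, so [e] times it is
    the negative of the real one; in total [1 - 3 = -2]. *)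
Lemma Dirac_slice_real (x : R) : U x%:A ->
  has_partials f x%:A /\ Dirac f x%:A = - 2 *: 'D_1 f x%:A.
Proof.
move=> Ux; have dom : slice_domain U (x, 0).
  have := slice_domain_point Ux; rewrite qim_norm /= !mulr0 expr0n /= !addr0.
  by rewrite sqrtr0 mulr1.
have d0 : is_derive (x%:A : H) 1 f (partial_u alpha (x, 0)).
  have := slice_derive_real_dir Ux; rewrite qim_norm /= !mulr0 expr0n /= !addr0.
  by rewrite sqrtr0 mulr1 invr0 scale0r addr0.
have [_ av _ _] := C1alpha dom; have [bu bv _ _] := C1beta dom.
have /partial_v_is_derive da := av; have /partial_v_is_derive db := bv.
(* [beta] vanishes on the real axis near [x]; by Cauchy-Riemann [partial_v alpha] then vanishes at
   [(x, 0)] too. *)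
have bu0 : partial_u beta (x, 0) = 0.
  have /partial_u_is_derive dbu := bu; rewrite -(@derive_val _ _ _ _ _ _ _ dbu).
  have z : is_derive x (1 : R) (cst 0 : R -> H) 0 := is_derive_cst 0 x 1.
  apply: derive_val; apply: near_eq_is_derive z; near=> s.
  rewrite /= slice_beta0//.
  have Us : U (x%:A + (s - x) *: 1) by near: s; exact: near_line.
  have := slice_domain_point Us; rewrite qim_norm /= !mulr0 !addr0 expr0n /=.
  by rewrite !addr0 sqrtr0 !mulr1 addrC subrK.
have de e : unit_imag e ->
    is_derive (x%:A : H) e f (e * partial_u alpha (x, 0)).
  move=> ue; apply/(is_derive_line _ _ _ _ 0).
  (* The signed parameter [s] replaces the modulus, which has a corner at 0. *)
  apply: (@near_eq_is_derive _ _ _ (fun s => alpha (x, s) + e * beta (x, s))).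
    near=> s; rewrite subr0 sliceE//.
    have Us : U (x%:A + (s - 0) *: e) by near: s; exact: near_line.
    have [e0 e1n] := ue.
    have := slice_domain_point Us.
    rewrite (_ : qim _ = s *: e); last first.
      by apply: quat_eqP; rewrite /= ?e0; ring.
    rewrite /= e0 mulr0 addr0 mulr1 normrZ e1n mulr1 => h.
    exact: slice_domain_normr.
  apply: is_derive_eq
    (is_deriveD da (is_derive_quatM (is_derive_cst e 0 (1 : R)) db)) _.
  have [-> ->] := cauchy_riemann dom.
  by rewrite bu0 oppr0 add0r mul0r addr0.
have d1 := de _ (@unit_imag_e1 R); have d2 := de _ (@unit_imag_e2 R).
have d3 := de _ (@unit_imag_e3 R).
split; first by split; apply: ex_derive.
rewrite /Dirac !derive_val.
by apply: quat_eqP => /=; ring.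
Unshelve. all: by end_near. Qed.

End DiracSlice.

(** * Termwise differentiation of quaternionic power series *)

Section PowerSeries.
Variable R : realType.
Local Notation H := (quaternion R).

(** A weakening of the tangent bound for [t ^+ n.+1 - s ^+ n.+1]. It absorbs the factor [n.+1]
    produced by differentiation into a larger radius. *)
Lemma expr_linear_le (s t : R) n : 0 <= s -> s < t ->
  n.+1%:R * s ^+ n <= (t - s)^-1 * t ^+ n.+1.
Proof.
move=> s0 st; rewrite ler_pdivlMl ?subr_gt0//.
elim: n => [|n IH]; first by rewrite expr0 !mulr1 expr1; lra.
have le_pow : s ^+ n.+1 <= t ^+ n.+1.
  by apply: lerXn2r => //; rewrite ?nnegrE ?ltW// (le_lt_trans s0).
have := ler_wpM2l s0 IH.
have := ler_wpM2l (ltW (_ : 0 < t - s)) le_pow; rewrite subr_gt0 => /(_ st).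
rewrite -(natr1 n.+1) [s ^+ n.+1]exprS [t ^+ n.+2]exprS; nra.
Qed.

Lemma norm_sum_expr_comm_le (x y : H) (s : R) n : `|x| <= s -> `|y| <= s ->
  `|\sum_(i < n.+1) x ^+ (n - i) * y ^+ i| <= n.+1%:R * s ^+ n.
Proof.
move=> xs ys; have s0 : 0 <= s by rewrite (le_trans _ xs).
rewrite (le_trans (ler_norm_sum _ _ _))//.
rewrite (@le_trans _ _ (\sum_(i < n.+1) s ^+ n))//; last first.
  by rewrite sumr_const card_ord mulr_natl.
apply: ler_sum => i _; rewrite quat_normM !quat_normX.
have -> : s ^+ n = s ^+ (n - i) * s ^+ i by rewrite -exprD subnK// -ltnS.
by apply: ler_pM; rewrite ?exprn_ge0//; apply: lerXn2r; rewrite ?nnegrE.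
Qed.

(* Tannery's argument: the difference quotients of the partial sums are
   dominated, uniformly in the increment, by an absolutely convergent series,
   so knowing that [g] has a derivative identifies it with the termwise one. *)
Lemma quat_power_series_derive (X c : H) (a : nat -> H) (s d : R) (g : R -> H) :
  `|X| < s -> 0 < d ->
  cvgn (series (fun n => s ^+ n * `|a n|)) ->
  (forall h : R, `|h| <= d ->
    series (fun n => (X + h%:A) ^+ n * a n) @ \oo --> g h) ->
  is_derive (0 : R) (1 : R) g c ->
  series (fun n => n.+1%:R *: (X ^+ n * a n.+1)) @ \oo --> c.
Proof.
move=> Xs d0 cvs gE /is_deriveE dg.
(* The gap between [|X|] and [t] leaves room for the increment [h], the gap between [t] and [s] for
   the factor [n.+1]. *)
pose t := (`|X| + s) / 2.
have [Xt ts] : `|X| < t /\ t < s by rewrite /t; split; lra.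
have t0 : 0 <= t by rewrite (le_trans _ (ltW Xt)).
(* This is the difference quotient of the term of index [n.+1], in polynomial form so that it is
   continuous at [h = 0]; the term of index 0 is constant. [w] is its majorant. *)
pose D h n := (\sum_(i < n.+1) (X + h%:A) ^+ (n - i) * X ^+ i) * a n.+1.
pose w n := (s - t)^-1 * (s ^+ n.+1 * `|a n.+1|).
have w0 n : 0 <= w n.
  by rewrite /w !mulr_ge0 ?invr_ge0 ?exprn_ge0//; lra.
have cvw : cvgn (series w).
  apply: is_cvg_seriesZ.
  have /cvg_ex[l cl] := cvs; apply/cvg_ex; exists (l - s ^+ 0 * `|a 0%N|).
  rewrite (_ : series _ = fun n =>
    series (fun n => s ^+ n * `|a n|) n.+1 - s ^+ 0 * `|a 0%N|).
    by apply: cvgB; [rewrite cvg_shiftS|exact: cvg_cst].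
  by apply/funext => n; rewrite /series /= big_nat_recl//= addrC addKr.
set L := limn (series w).
have wL n : series w n <= L.
  by apply: nondecreasing_cvgn_le => //; exact: nondecreasing_series.
have D_le h n : `|h| <= t - `|X| -> `|D h n| <= w n.
  move=> hX; rewrite /D /w quat_normM mulrA ler_wpM2r//.
  rewrite (le_trans _ (expr_linear_le n t0 ts))//.
  apply: norm_sum_expr_comm_le; last exact: ltW.
  rewrite (le_trans (ler_normD _ _))// normrZ.
  have -> : `|1 : H| = 1 by have := quat_normX (1 : H) 0; rewrite expr0.
  lra.
have DE h n : h *: D h n = (X + h%:A) ^+ n.+1 * a n.+1 - X ^+ n.+1 * a n.+1.
  rewrite -mulrBl subrXX_comm/=; last first.
    by apply/commr_sym/commrD => //; exact/commr_sym/comm_alg.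
  by rewrite addrAC subrr add0r mulr_algl scalerAl.
have cvD h : `|h| <= d -> h != 0 ->
    series (D h) @ \oo --> h^-1 *: (g h - g 0).
  move=> hd hn0.
  rewrite (_ : series (D h) = fun n => h^-1 *:
      (series (fun n => (X + h%:A) ^+ n * a n) n.+1
       - series (fun n => (X + (0 : R)%:A) ^+ n * a n) n.+1)).
    apply: cvgZl_tmp; apply: cvgB; rewrite cvg_shiftS; apply: gE => //.
    by rewrite normr0 ltW.
  apply/funext => n; rewrite /series /= -sumrB big_nat_recl//= !expr0 subrr add0r.
  rewrite scaler_sumr; apply: eq_bigr => i _.
  by rewrite scale0r addr0 -DE scalerA mulVf// scale1r.
(* The remainder after [N] terms is at most the tail of the majorant, a bound free of [h]. *)
have tail h N : `|h| <= d -> `|h| <= t - `|X| -> h != 0 ->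
    `|h^-1 *: (g h - g 0) - series (D h) N| <= L - series w N.
  move=> hd hX hn0; apply: (@cvgr_to_le _ \oo _ _
      (fun M => `|series (D h) M - series (D h) N|)).
    by apply: cvg_norm; apply: cvgB; [exact: cvD|exact: cvg_cst].
  near=> M; have NM : (N <= M)%N by near: M; exists N.
  rewrite (@le_trans _ _ (series w M - series w N)) ?lerD2r//.
  rewrite !sub_series_geq// (le_trans (ler_norm_sum _ _ _))//.
  by apply: ler_sum => n _; exact: D_le.
set S := series _.
(* With [N] fixed, [h] tends to 0 in [tail]; the finite sum of the [D h n] tends to [S N]. *)
have S_le N : `|c - S N| <= L - series w N.
  apply: (@cvgr_to_le _ (0 : R)^' _ _
      (fun h => `|h^-1 *: (g (h *: 1 + 0) - g 0) - series (D h) N|)).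
    apply: cvg_norm; apply: cvgB => //; rewrite /S /series /=.
    apply: cvg_quat_sum => n; rewrite scalerAl.
    apply: cvg_quatM; last exact: cvg_cst.
    rewrite (_ : n.+1%:R *: X ^+ n = \sum_(i < n.+1) X ^+ (n - i) * X ^+ i).
      apply: cvg_quat_sum => i; apply: cvg_quatM; last exact: cvg_cst.
      apply: cvg_quatX; rewrite -[X in _ --> X]addr0 -[X in _ --> _ + X](scale0r 1).
      apply: cvgD; first exact: cvg_cst.
      by apply: cvgZr_tmp; exact: cvg_within.
    rewrite (eq_bigr (fun=> X ^+ n)); first by rewrite sumr_const card_ord scaler_nat.
    by move=> i _; rewrite -exprD subnK// -ltnS.
  near=> h; rewrite addr0 -[h *: 1]/(h * 1) mulr1; apply: tail.
  - by near: h; apply: dnbhs0_le.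
  - by near: h; apply: dnbhs0_le; rewrite subr_gt0.
  - by near: h; exact: nbhs_dnbhs_neq.
apply/cvgrPdist_le => e e0; near=> N; apply: (le_trans (S_le N)).
rewrite (le_trans (ler_norm _))//; near: N.
by move: e e0; apply/cvgrPdist_le.
Unshelve. all: by end_near. Qed.

End PowerSeries.

(** * Summing the series of [Htilde] at nonreal and at real points *)

Section StarTaylor.
Variable R : realType.
Local Notation H := (quaternion R).
Variables (f : H -> H) (p : H) (a b : nat -> H) (r : \bar R).
Hypothesis taylorf : star_taylor_on (Omega p r) f p a.
Hypothesis bE : forall n, b n = - (2 * n.+1%:R) * a n.+1.

Lemma star_taylor_cvg q : Omega p r q ->
  cvgn [normed series (star_taylor_term a p ^~ q)] /\
  series (star_taylor_term a p ^~ q) @ \oo --> f q.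
Proof.
move=> Oq; have sub1 : [set q] `<=` Omega p r by move=> _ ->.
have [nrm] := taylorf (@compact_set1 _ q) sub1.
by rewrite uniform_set1; split=> //; exact: nrm.
Qed.

Lemma bE_scale n : b n = (- (2 * n.+1%:R) : R) *: a n.+1.
Proof. by rewrite bE -mulr_algl -!natrM scaleNr scaler_nat. Qed.

(** The two disc conditions do not involve [J] and are exchanged by [v] to [-v]. *)
Lemma Omega_swap (u v : R) I J : unit_imag I -> slice I p -> unit_imag J ->
  slice_disc I p r (u%:A + v *: I) -> slice_disc I p r (u%:A - v *: I) ->
  Omega p r (u%:A + v *: J) /\ Omega p r (u%:A - v *: J).
Proof.
move=> uI Ip uJ D1 D2; split; first by exists I, J, u, v.
by exists I, J, u, (- v); rewrite !scaleNr !opprK.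
Qed.

Lemma series_Htilde_nonreal (u v : R) I J : unit_imag I -> slice I p ->
  unit_imag J -> v != 0 ->
  slice_disc I p r (u%:A + v *: I) -> slice_disc I p r (u%:A - v *: I) ->
  series (fun n => Htilde n (u%:A + v *: J) p * b n) @ \oo -->
  v^-1 *: (J * (f (u%:A + v *: J) - f (u%:A - v *: J))).
Proof.
move=> uI Ip uJ v0 D1 D2.
have [/star_taylor_cvg[_ c1] /star_taylor_cvg[_ c2]] := Omega_swap uI Ip uJ D1 D2.
move: c1 c2; set q := _ + _; set qc := _ - _ => c1 c2.
(* The terms of index 0 at [q] and [qc] cancel, whence the shift to [n.+1]; [J * J = -1] produces
   the sign of [b n]. *)
rewrite (_ : series _ = fun n => v^-1 *: (J *
    (series (star_taylor_term a p ^~ q) n.+1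
     - series (star_taylor_term a p ^~ qc) n.+1))).
  apply: cvgZl_tmp; apply: cvg_quatM; first exact: cvg_cst.
  by apply: cvgB; rewrite cvg_shiftS.
apply/funext => n; rewrite /series /= -sumrB big_nat_recl//=.
rewrite {1 2}/star_taylor_term /star_pow !big_ord1 !expr0 subrr add0r.
rewrite mulr_sumr scaler_sumr; apply: eq_bigr => i _.
rewrite /star_taylor_term -mulrBl (star_pow_conj_sub u v i uI uJ Ip) bE_scale.
rewrite -/q; move: (Htilde _ _ _) => h; set k := 2 * v * _.
rewrite -!scalerAl -!scalerAr !mulrA (unit_imag_sqr uJ) mulN1r mulNr.
by rewrite /k; move: (h * _) => z; apply: quat_eqP => /=; field.
Qed.

Lemma slice_disc_real (x h : R) I : unit_imag I ->
  (`|x%:A - p|%:E + `|h|%:E < r)%E -> slice_disc I p r (x + h)%:A.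
Proof.
move=> uI xh; split; first by exists (x + h), 0; rewrite scale0r addr0.
rewrite /=; apply: le_lt_trans xh; rewrite -EFinD lee_fin scalerDl addrAC.
rewrite (le_trans (ler_normD _ _))// lerD2l normrZ.
by have := quat_normX (1 : H) 0; rewrite expr0 => ->; rewrite mulr1.
Qed.

(** Moving [x] away from [q0 p] enlarges one coordinate of the difference and fixes the others. This
    supplies the larger radius for [quat_power_series_derive]. *)
Lemma quat_norm_away (x d : R) : 0 < d ->
  exists2 h, `|h| = d & `|x%:A - p| < `|(x + h)%:A - p|.
Proof.
move=> d0; have [px|xp] := leP (q0 p) x.
  exists d; first by rewrite gtr0_norm.
  rewrite -ltr_sqr ?nnegrE// !quat_sqr_norm /=; nra.
exists (- d); first by rewrite normrN gtr0_norm.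
rewrite -ltr_sqr ?nnegrE// !quat_sqr_norm /=; nra.
Qed.

Lemma star_pow_real (x : R) n : star_pow x%:A p n = (x%:A - p) ^+ n.
Proof. by rewrite exprB_comm_sum//; exact: comm_alg. Qed.

(** For [v = 0] one has [A = B], so all [n.+1] summands of [Htilde_repr] coincide. *)
Lemma Htilde_real (x : R) I n : unit_imag I -> slice I p ->
  Htilde n x%:A p = (x%:A - p) ^+ n.
Proof.
move=> uI Ip; have := Htilde_repr x 0 uI uI Ip n.
rewrite !scale0r !addr0 subr0.
rewrite (eq_bigr (fun=> (x%:A - p) ^+ n)); last first.
  by move=> i _; rewrite -exprD subnK// -ltnS.
rewrite sumr_const card_ord -[RHS]scaler_nat => /scalerI; apply.
by rewrite pnatr_eq0.
Qed.

Lemma series_Htilde_real (x : R) I : unit_imag I -> slice I p ->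
  slice_disc I p r x%:A -> derivable f x%:A 1 ->
  series (fun n => Htilde n x%:A p * b n) @ \oo --> - 2 *: 'D_1 f x%:A.
Proof.
move=> uI Ip [_ /= xr] df.
(* [d] is a margin keeping the real segment around [x] inside [Omega p r]; for infinite [r] any
   positive value works. *)
have [d d0 dr] : exists2 d : R, 0 < d & (`|x%:A - p|%:E + d%:E < r)%E.
  move: xr; case: r => [s| |]//; last by exists 1; rewrite // ltry.
  rewrite lte_fin => xs; exists ((s - `|x%:A - p|) / 2); first lra.
  by rewrite -EFinD lte_fin; lra.
have Oh h : `|h| <= d -> Omega p r (x + h)%:A.
  move=> hd; have D : slice_disc I p r ((x + h)%:A + 0 *: I).
    rewrite scale0r addr0; apply: slice_disc_real => //.
    by apply: le_lt_trans dr; rewrite leeD2l// lee_fin.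
  exists I, I, (x + h), 0; split => //; last by rewrite scale0r addr0.
  by move: D; rewrite scale0r addr0 subr0.
have [h0 h0d away] := quat_norm_away x d0.
have cva : cvgn (series (fun n => `|(x + h0)%:A - p| ^+ n * `|a n|)).
  have Oh0 : Omega p r (x + h0)%:A by apply: Oh; rewrite h0d.
  have [+ _] := star_taylor_cvg Oh0.
  rewrite (_ : [normed _] = series (fun n => `|(x + h0)%:A - p| ^+ n * `|a n|))//.
  congr series; apply/funext => n /=.
  by rewrite /star_taylor_term star_pow_real quat_normM quat_normX.
have dg : is_derive (0 : R) (1 : R) (fun h => f (x + h)%:A) ('D_1 f x%:A).
  rewrite (_ : (fun h => _) = fun h => f (x%:A + (h - 0) *: 1)); last first.
    by apply/funext => h; rewrite subr0 scalerDl.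
  by apply/is_derive_line; exact: derivableP.
have := quat_power_series_derive away d0 cva _ dg.
rewrite (_ : (fun n => Htilde n x%:A p * b n) =
    (- 2 : R) \*: (fun n : nat => n.+1%:R *: ((x%:A - p) ^+ n * a n.+1))); last first.
  apply/funext => n /=; rewrite (Htilde_real x n uI Ip) bE_scale -scalerAr scalerA.
  by rewrite mulNr.
move=> cvS; rewrite (_ : series _ = (- 2 : R) \*:
    series (fun n : nat => n.+1%:R *: ((x%:A - p) ^+ n * a n.+1))); last first.
  by apply/funext => n; rewrite /series /= scaler_sumr.
apply: cvgZl_tmp; apply: cvS => h hd.
have [_] := star_taylor_cvg (Oh h hd).
by under eq_fun do rewrite /star_taylor_term star_pow_real scalerDl addrAC.
Qed.

End StarTaylor.

(** * The expansion of [Dirac f] on [Omega p r] *)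

Theorem theorem5p6 (R : realType) (U : set (quaternion R))
    (f : quaternion R -> quaternion R) (p : quaternion R)
    (a b : nat -> quaternion R) (r : \bar R)
    (openU : open U) (symU : axially_symmetric U)
    (holf : slice_hyperholomorphic U f) (Up : U p)
    (r_gt0 : (0 < r)%E) (rE : (r^-1)%E = root_limsup a)
    (Omega0 : Omega p r !=set0) (OmegaU : Omega p r `<=` U)
    (taylorf : star_taylor_on (Omega p r) f p a)
    (bE : forall n, b n = - (2 * n.+1%:R) * a n.+1) :
  forall q, Omega p r q ->
    has_partials f q /\
    series (fun n => Htilde n q p * b n) @ \oo --> Dirac f q.
Proof.
move=> q Oq; have [I [J [x [y [[uI Ip] uJ D1 D2 qE]]]]] := Oq.
have [al [be [[C1al C1be] par CR slE]]] := holf.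
have Uq := OmegaU _ Oq.
have [y0|y0] := eqVneq y 0.
  move: qE D1 D2; rewrite {}y0 !scale0r !addr0 => qE D1 _; subst q.
  have [par_q ->] := Dirac_slice_real openU symU C1al C1be par CR slE Uq.
  split=> //; apply: (series_Htilde_real taylorf bE uI Ip D1).
  by case: par_q.
have [J0 J1] := uJ.
have imq : qim q = y *: J.
  by rewrite qE; apply: quat_eqP; rewrite /= ?J0; ring.
have req : q0 q = x by rewrite qE /= J0; ring.
have nq : `|qim q| = `|y| by rewrite imq normrZ J1 mulr1.
have qn0 : qim q != 0 by rewrite -normr_eq0 nq normr_eq0.
have [pq ->] := Dirac_slice_nonreal openU symU C1al C1be par CR slE Uq qn0.
split=> //; rewrite nq req.
have dom K : unit_imag K -> U (x%:A + y *: K).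
  by move=> uK; apply: OmegaU; have [] := Omega_swap uI Ip uK D1 D2.
have := series_Htilde_nonreal taylorf bE uI Ip uJ y0 D1 D2.
(* By the slice formula at [J] and [-J], [f] differs between [q] and its conjugate by
   [2 J be (x, y)]. *)
rewrite -qE (_ : y^-1 *: _ = - (2 / `|y|) *: be (x, `|y|))//.
have -> : f (x%:A - y *: J) = al (x, y) - J * be (x, y).
  by rewrite -scalerN slE ?mulNr//; exact: unit_imagN.
rewrite qE slE// opprB [_ + (_ - _)]addrC addrA subrK.
(* [y] may be negative while the formula for [Dirac f] uses the modulus; oddness of [be] supplies
   the sign. *)
have -> : be (x, y) = (y / `|y|) *: be (x, `|y|).
  have [_|ylt] := ger0P y; first by rewrite divff// scale1r.
  by have [_ ->] := par x y dom; rewrite invrN mulrN divff// scalerN scaleN1r opprK.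
have ny0 : `|y| != 0 by rewrite normr_eq0.
move: (be _) => c.
rewrite -!mulrDr mulrA unit_imag_sqr// mulN1r.
by apply: quat_eqP => /=; field; rewrite ny0.
Qed.
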